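(* Let $\mathcal G$ be a hypergraph with $c:=\operatorname{crk}(\mathcal G)\ge 3$ and $k:=\operatorname{rk}(\mathcal G)$. If the incidence graph $\mathscr I(\mathcal G)$ is $\left(1+\lceil k/c\rceil\right)$-edge-connected (equivalently, in the paper's terminology, $\mathcal G$ is $\left(1+\lceil k/c\rceil\right)$-flag-connected), then $\mathcal G$ is quasi-Eulerian.
   Context: A hypergraph $\mathcal G=(V,E)$ consists of a finite vertex set $V$ and a finite multiset $E$ of nonempty subsets of $V$ (edges; repeated edges allowed). $\operatorname{rk}(\mathcal G)=\max\{|e|:e\in E\}$ and $\operatorname{crk}(\mathcal G)=\min\{|e|:e\in E\}$. The incidence graph $\mathscr I(\mathcal G)$ is the simple bipartite graph with one part $V$, the other part having one vertex for each member of the multiset $E$, and $v$ adjacent to $e$ iff $v\in e$. A closed walk in $\mathcal G$ is a cyclic sequence $v_1,e_1,v_2,e_2,\dots,v_t,e_t$ of vertices $v_i$ and edges $e_i$ with $\{v_i,v_{i+1}\}\subseteq e_i$ and $v_i\neq v_{i+1}$ for all $i$ (indices modulo $t$). An Euler family is a finite family of closed walks such that every edge of $\mathcal G$ (each member of the multiset $E$) occurs exactly once in total among the edge-entries of all the walks; $\mathcal G$ is quasi-Eulerian if it has an Euler family. Equivalently, $\mathcal G$ is quasi-Eulerian iff $\mathscr I(\mathcal G)$ has a subgraph in which every vertex has even degree and every vertex corresponding to an edge of $\mathcal G$ has degree exactly $2$. *)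

(* Defs.v *)
From mathcomp Require Import all_boot.
Set Implicit Arguments. Unset Strict Implicit. Unset Printing Implicit Defensive.

(* A hypergraph: vertex set V (finType), edge multiset indexed by the finType E,
   with edge e being the vertex set [inc e]. Repeated edges = distinct indices
   with equal [inc]. *)

Section Hyper.
Variables (V E : finType) (inc : E -> {set V}).

Definition is_hypergraph : Prop := forall e : E, inc e != set0.

Definition rk : nat := \max_(e : E) #|inc e|.
(* corank: minimum edge size (equals 0 when there are no edges) *)
Definition crk : nat := \big[minn/rk]_(e : E) #|inc e|.

(* The incidence graph: vertex set V + E; its edges are the flags (v,e) with
   v \in inc e.  [inc_adj F] is the adjacency of the incidence graph with the
   set of flags F deleted. *)
Definition flags : {set V * E} := [set p | p.1 \in inc p.2].

Definition inc_adj (F : {set V * E}) : rel (V + E) :=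
  fun x y => match x, y with
             | inl v, inr e => (v \in inc e) && ((v, e) \notin F)
             | inr e, inl v => (v \in inc e) && ((v, e) \notin F)
             | _, _ => false
             end.

Definition inc_connected_minus (F : {set V * E}) : Prop :=
  forall x y : V + E, connect (inc_adj F) x y.

Definition inc_edge_connected (l : nat) : Prop :=
  forall F : {set V * E}, F \subset flags -> #|F| < l -> inc_connected_minus F.

(* A closed walk v_1,e_1,...,v_t,e_t, stored as [:: (v_1,e_1); ...; (v_t,e_t)],
   indices cyclic: {v_i, v_{i+1}} \subseteq e_i and v_i != v_{i+1}. *)
Definition closed_walk (w : seq (V * E)) : bool :=
  all (fun t : (V * E) * V =>
         let: ((v, e), v') := t in [&& v \in inc e, v' \in inc e & v != v'])
      (zip w (rot 1 (map fst w))).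

Definition euler_family (W : seq (seq (V * E))) : Prop :=
  all closed_walk W /\
  forall e : E, count (fun p : V * E => p.2 == e) (flatten W) = 1.

Definition quasi_eulerian : Prop := exists W, euler_family W.

End Hyper.

(* Main.v *)
Require Import Defs.
From mathcomp Require Import all_boot.
From mathcomp Require Import zify.
Set Implicit Arguments. Unset Strict Implicit. Unset Printing Implicit Defensive.

(* Replace every vertex by a clique of even size and every hyperedge by two twin
   nodes, so that a perfect matching picks two distinct vertices in each
   hyperedge with even total multiplicity at each vertex. If there is no perfect
   matching, Tutte's theorem gives a barrier: a set S and more than |S| odd sets
   partitioning the complement and closed under adjacency off S. When |S| is
   minimal, every node of S is adjacent to at least three of the odd sets, and
   this forces S to consist of both twins of some hyperedges (set SE) and of all
   flags of some other hyperedges (set T). An odd set without twins of T has a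
   coboundary in the incidence graph made of t flags of T, with t odd, and s flags
   of SE, and t + s > ceil(k/c) gives k (c - 2) t + 2 c s >= c k. Summing over the
   odd sets contradicts the barrier inequality. *)

(** * The Tutte-Berge formula, after Gallai *)

Lemma odd_fixed_points (T : finType) (f : T -> T) (A : {set T}) :
  involutive f -> {in A, forall x, f x \in A} ->
  odd #|A| = odd #|[set x in A | f x == x]|.
Proof.
move=> fK; have [n] := ubnP #|A|; elim: n A => // n IHn A leAn fA.
case: (pickP [pred x in A | f x != x]) => [x /andP[Ax fxx]|fix_A].
  have Afx := fA x Ax.
  have Dfx : f x \in A :\ x by rewrite !inE fxx Afx.
  have cA : #|A| = (#|A :\ x :\ f x|).+2.
    by rewrite (cardsD1 x) Ax (cardsD1 (f x) (A :\ x)) Dfx.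
  rewrite cA /= negbK IHn; first last.
  - move=> y; rewrite !inE => /and3P[y1 y2 Ay]; rewrite fA // andbT.
    rewrite (inj_eq (can_inj fK)) y2 /=.
    by apply: contraNneq y1 => <-; rewrite fK.
  - lia.
  congr (odd _); apply: eq_card => y; rewrite !inE.
  case: (y =P x) => [->|_]; first by rewrite (negPf fxx) !andbF.
  by case: (y =P f x) => [->|//]; rewrite fK eq_sym (negPf fxx) !andbF.
congr (odd _); apply: eq_card => x; rewrite !inE.
by have := fix_A x; rewrite /=; case: (x \in A) => //= /negbFE.
Qed.

Section Dihedral.
Variables (T : Type) (f g : T -> T) (v : T).
Hypotheses (fK : involutive f) (gK : involutive g) (gv : g v = v).
Let h x := g (f x).

(** Conjugation by [g] inverts [h], and [g] fixes [v], so [g] sends the iterate of index [i] to the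
    one of index [-i]. When [f] and [g] are matchings, these iterates run along the alternating path
    from [v]. *)
Lemma iter_reflect i n : g (iter i h v) = iter n h v -> iter (n + i) h v = v.
Proof.
elim: i n => [|i IHi] n /=; first by rewrite addn0 gv.
rewrite /h gK -/h => e; rewrite addnS -addSn; apply: IHi.
by rewrite iterS -e /h fK.
Qed.

Lemma iter_fixed i : f (iter i h v) = iter i h v -> iter (i.*2.+1) h v = v.
Proof.
by move=> e; rewrite -addnn -addSn; apply: iter_reflect; rewrite iterS {2}/h e.
Qed.

(* [iter (i + j + 2ij) h v] equals both [iter i h v] and [iter j h v]. *)
Lemma iter_fixed_unique i j :
  f (iter i h v) = iter i h v -> f (iter j h v) = iter j h v ->
  iter i h v = iter j h v.
Proof.
move=> /iter_fixed ei /iter_fixed ej.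
have {1}<- : iter (j * i.*2.+1) h v = v by rewrite iterM iter_fix.
have {2}<- : iter (i * j.*2.+1) h v = v by rewrite iterM iter_fix.
rewrite -!iterD; congr (iter _ _ _); lia.
Qed.
End Dihedral.

Section TutteBerge.
Variables (T : finType) (r : rel T).
Hypothesis r_sym : symmetric r.
Implicit Types (U S A : {set T}) (f g : {ffun T -> T}) (P : {set {set T}}).

(** A matching is encoded as an involution of the whole type, whose fixed points are the unmatched
    nodes. *)
Definition matching U f :=
  [forall x, (f (f x) == x) &&
             ((f x == x) || [&& x \in U, f x \in U & r x (f x)])].

Definition missed U f := [set x in U | f x == x].

Definition maximum U f :=
  matching U f && [forall g, matching U g ==> (#|missed U f| <= #|missed U g|)].

Lemma matchingP U f :
  reflect (involutive f /\
           forall x, f x != x -> [/\ x \in U, f x \in U & r x (f x)])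
          (matching U f).
Proof.
apply: (iffP forallP) => [m|[fK m] x].
  split=> [x|x fx]; first by case/andP: (m x) => /eqP.
  by case/andP: (m x) => _; rewrite (negPf fx) => /and3P.
rewrite fK eqxx /=; case: eqVneq => //= /m[-> -> ->].
by [].
Qed.

Lemma maximumP U f :
  reflect (matching U f /\
           forall g, matching U g -> #|missed U f| <= #|missed U g|)
          (maximum U f).
Proof.
apply: (iffP andP) => [[m /forallP mf]|[m mf]]; split=> //.
  by move=> g mg; have /implyP := mf g; apply.
by apply/forallP => g; apply/implyP/mf.
Qed.

Lemma maximum_exists U : exists f, maximum U f.
Proof.
have m1 : matching U [ffun x => x].
  by apply/matchingP; split=> [x|x]; rewrite !ffunE ?eqxx.
case: (arg_minnP (fun f => #|missed U f|) m1) => f mf minf.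
by exists f; apply/maximumP.
Qed.

Lemma missed_not_adjacent U f x y :
  maximum U f -> x \in missed U f -> y \in missed U f -> x != y -> ~~ r x y.
Proof.
move=> /maximumP[/matchingP[fK mf] minf]; rewrite !inE => /andP[Ux /eqP fx].
move=> /andP[Uy /eqP fy] nxy; apply/negP => rxy.
pose g := [ffun z => if z == x then y else if z == y then x else f z].
have gx : g x = y by rewrite ffunE eqxx.
have gy : g y = x by rewrite ffunE eqxx eq_sym (negPf nxy).
have gz z : z != x -> z != y -> g z = f z.
  by rewrite ffunE => /negPf-> /negPf->.
have fne z a : f a = a -> z != a -> f z != a.
  by move=> fa; apply: contraNneq => fz; rewrite -[z]fK fz fa.
have mg : matching U g.
  apply/matchingP; split=> z.
    have [->|nzx] := eqVneq z x; first by rewrite gx gy.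
    have [->|nzy] := eqVneq z y; first by rewrite gy gx.
    by rewrite (gz z nzx nzy) (gz _ (fne _ _ fx nzx) (fne _ _ fy nzy)) fK.
  have [->|nzx] := eqVneq z x; first by rewrite gx.
  have [->|nzy] := eqVneq z y; first by rewrite gy r_sym.
  by rewrite gz //; apply: mf.
have := minf g mg; rewrite leqNgt => /negP; apply; apply: proper_card.
apply/properP; split.
  apply/subsetP => z; rewrite !inE => /andP[-> /eqP gzz] /=.
  have [zx|nzx] := eqVneq z x; first by rewrite zx fx.
  have [zy|nzy] := eqVneq z y; first by rewrite zy fy.
  by rewrite -gz // gzz.
by exists x; rewrite !inE ?Ux ?fx ?eqxx // gx eq_sym.
Qed.

Definition glue A f g := [ffun x => if x \in A then f x else g x].

Lemma glue_matching U A f g :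
  matching U f -> matching U g ->
  {in A, forall x, f x \in A} -> {in A, forall x, g x \in A} ->
  matching U (glue A f g).
Proof.
move=> /matchingP[fK mf] /matchingP[gK mg] fA gA.
have gA' x : x \notin A -> g x \notin A.
  by apply: contra => /gA; rewrite gK.
apply/matchingP; split=> x; rewrite !ffunE; case: (boolP (x \in A)) => Ax.
- by rewrite fA.
- by rewrite (negPf (gA' x Ax)).
- exact: mf.
- exact: mg.
Qed.

Lemma missed_glue U A f g :
  #|missed U (glue A f g)| = #|missed U f :&: A| + #|missed U g :\: A|.
Proof.
rewrite -(cardsID A); congr (_ + _); apply: eq_card => x; rewrite !inE ffunE.
  by case: (x \in A); rewrite ?andbT ?andbF.
by case: (x \in A); rewrite ?andbT ?andbF.
Qed.

(** [glue A f g] and [glue A g f] together miss as many nodes as [f] and [g] do, so both attain the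
    minimum. *)
Lemma maximum_glue U A f g :
  maximum U f -> maximum U g ->
  {in A, forall x, f x \in A} -> {in A, forall x, g x \in A} ->
  maximum U (glue A f g).
Proof.
move=> /maximumP[mf minf] /maximumP[mg ming] fA gA.
have := ming _ (glue_matching mf mg fA gA).
have := minf _ (glue_matching mg mf gA fA).
rewrite !missed_glue -(cardsID A (missed U f)) -(cardsID A (missed U g)).
rewrite leq_add2r leq_add2r => le1 le2.
apply/maximumP; split=> [|k mk]; first exact: glue_matching.
apply: leq_trans (minf k mk); rewrite missed_glue -(cardsID A (missed U f)).
have := minf _ mg; rewrite -(cardsID A (missed U f)) -(cardsID A (missed U g)).
have := ming _ mf; rewrite -(cardsID A (missed U f)) -(cardsID A (missed U g)).
lia.
Qed.

(** Gallai's relation: when every node of [U] is missed by some maximum matching, its classes are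
    the odd sets. *)
Definition linked U x y :=
  (x == y) || [forall f, maximum U f ==> ~~ ((x \in missed U f) && (y \in missed U f))].

Lemma linkedP U x y :
  reflect (x = y \/ forall f, maximum U f -> x \in missed U f -> y \notin missed U f)
          (linked U x y).
Proof.
apply: (iffP orP) => [[/eqP|/forallP l]|[->|l]]; [by left| |by left|right].
  by right=> f mf fx; have := l f; rewrite mf fx.
by apply/forallP => f; apply/implyP => mf; apply/negP => /andP[/(l f mf)/negP].
Qed.

Lemma linked_sym U : symmetric (linked U).
Proof.
suff imp x y : linked U x y -> linked U y x by move=> x y; apply/idP/idP; apply: imp.
case/linkedP=> [->|l]; apply/linkedP; [by left | right=> f mf].
exact/contraL/l.
Qed.

Lemma adjacent_linked U x y : x \in U -> y \in U -> r x y -> linked U x y.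
Proof.
move=> Ux Uy rxy; have [->|nxy] := eqVneq x y; first by apply/linkedP; left.
apply/linkedP; right=> f mf fx; apply/negP => fy.
by have /negP := missed_not_adjacent mf fx fy nxy.
Qed.

(* If [f] misses [u] and [w] while [g] misses [v], the alternating component of
   [v] in [f] and [g] contains at most one of [u], [w]; exchanging [f] and [g]
   on it leaves the other one and [v] both missed. *)
Lemma linked_trans U v :
  (exists2 g, maximum U g & v \in missed U g) ->
  forall u w, linked U u v -> linked U v w -> linked U u w.
Proof.
move=> [g mg gv] u w /linkedP[->//|luv] /linkedP[<-|lvw].
  by apply/linkedP; right.
have [->|nuw] := eqVneq u w; first by apply/linkedP; left.
apply/linkedP; right=> f mf fu; apply/negP => fw.
have [/matchingP[fK _] _] := maximumP _ _ mf.
have [/matchingP[gK _] _] := maximumP _ _ mg.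
have gvv : g v = v by move: gv; rewrite inE => /andP[_ /eqP].
have [A inA] : exists A : {set T},
    forall x, (x \in A) = connect (fun y z => (z == f y) || (z == g y)) v x.
  by exists [set x | connect (fun y z => (z == f y) || (z == g y)) v x] => x; rewrite inE.
have fA : {in A, forall x, f x \in A}.
  move=> x; rewrite !inA => /connect_trans; apply.
  by apply: connect1; rewrite eqxx.
have gA : {in A, forall x, g x \in A}.
  move=> x; rewrite !inA => /connect_trans; apply.
  by apply: connect1; rewrite eqxx orbT.
have vA : v \in A by rewrite inA connect0.
pose h x := g (f x).
(* As [g] fixes [v], the component of [v] is a path, all of it reached by applying [f] and [g]
   alternately from [v]. *)
have orbA x : x \in A -> exists i, x = iter i h v \/ x = f (iter i h v).
  rewrite inA => /connectP[p + ->].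
  elim/last_ind: p => [|p y IHp]; first by exists 0; left.
  rewrite rcons_path last_rcons => /andP[/IHp[i e]] /orP[]/eqP->.
    by exists i; case: e => ->; [right|left; rewrite fK].
  case: e => ->; last by exists i.+1; left.
  case: i => [|i]; first by exists 0; left.
  by exists i; right; rewrite /= /h gK.
have fixA x : f x = x -> x \in A -> exists i, x = iter i h v.
  move=> fx /orbA[i [->|e]]; first by exists i.
  by exists i; rewrite -fx e fK.
have fixf x : x \in missed U f -> f x = x by rewrite inE => /andP[_ /eqP].
have mgf := maximum_glue mg mf gA fA.
have vm : v \in missed U (glue A g f).
  by move: gv; rewrite !inE ffunE vA.
have mout x : x \in missed U f -> x \notin A -> x \in missed U (glue A g f).
  by rewrite !inE ffunE => fx /negPf->.
case: (boolP (u \in A)) => uA; last first.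
  by have := luv _ mgf (mout u fu uA); rewrite vm.
case: (boolP (w \in A)) => wA; last first.
  by have := lvw _ mgf vm; rewrite (mout w fw wA).
have [i eu] := fixA u (fixf _ fu) uA; have [j ew] := fixA w (fixf _ fw) wA.
case/eqP: nuw; rewrite eu ew; apply: (iter_fixed_unique fK gK gvv).
  by rewrite -/h -eu fixf.
by rewrite -/h -ew fixf.
Qed.

(** Members of [P] need not be connected, so several components may be merged into one odd set. *)
Definition barrier U S P :=
  [/\ S \subset U, partition P (U :\: S) &
      forall B, B \in P ->
        odd #|B| /\
        forall x y, x \in B -> y \in U :\: S -> r x y -> y \in B].

(** Induction on [#|U|]: a node covered by every maximum matching is deleted and put into [S]. If
    there is none, [S] is empty and the odd sets are the classes of [linked]. *)
Theorem tutte_berge U :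
  exists f S P, [/\ matching U f, barrier U S P & #|S| + #|missed U f| <= #|P|].
Proof.
have [n] := ubnP #|U|; elim: n U => // n IHn U ltUn.
have [f mf] := maximum_exists U.
have /maximumP[mff minf] := mf.
have missed_odd g : matching U g -> odd #|missed U g| = odd #|U|.
  move=> /matchingP[gK mg]; apply/esym/(odd_fixed_points gK) => x Ux.
  by have [->//|/mg[]] := eqVneq (g x) x.
case: (pickP [pred v in U | [forall g, maximum U g ==> (v \notin missed U g)]]).
  move=> v /andP[Uv /forallP vcov].
  have [|f' [S [P [mf' [SU pP bP] leP]]]] := IHn (U :\ v).
    by rewrite (cardsD1 v) Uv in ltUn; lia.
  have mUf' : matching U f'.
    case/matchingP: mf' => f'K mf'; apply/matchingP; split=> // x /mf'[].
    by rewrite !inE => /andP[_ ->] /andP[_ ->].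
  have f'v : f' v = v.
    apply/eqP/negPn/negP; case/matchingP: mf' => _ mf' /mf'[].
    by rewrite !inE eqxx.
  have vm : v \in missed U f' by rewrite inE Uv f'v eqxx.
  have cm : #|missed U f'| = #|missed (U :\ v) f'|.+1.
    rewrite (cardsD1 v) vm; congr (_.+1); apply: eq_card => x.
    by rewrite !inE; case: eqP.
  have vS : v \notin S by apply: contraL (vm) => /(subsetP SU); rewrite !inE eqxx.
  exists f, (v |: S), P; split=> //.
    have UvS : U :\: (v |: S) = (U :\ v) :\: S.
      by apply/setP => x; rewrite !inE negb_or -!andbA; do !bool_congr.
    split; rewrite ?UvS //.
    by rewrite subUset sub1set Uv (subset_trans SU) // subD1set.
  rewrite cardsU1 vS; apply: leq_trans leP; rewrite addnAC addnC leq_add2l.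
  (* [f'] misses [v], so it is not maximum on [U]; by parity it misses at least two nodes more than
     [f], one of them being [v]. The other pays for adding [v] to [S]. *)
  have := minf _ mUf'; rewrite leq_eqVlt => /orP[/eqP e|].
    have mf2 : maximum U f' by apply/maximumP; split=> // g /minf; rewrite e.
    by have := vcov f'; rewrite mf2 vm.
  have := missed_odd f mff; have := missed_odd f' mUf'; rewrite cm; lia.
move=> nocov.
have crit v : v \in U -> exists2 g, maximum U g & v \in missed U g.
  move=> Uv; have := nocov v; rewrite /= Uv /= => /negbT.
  rewrite negb_forall => /existsP[g]; rewrite negb_imply negbK => /andP[mg gv].
  by exists g.
have ltr v u w : v \in U -> linked U u v -> linked U v w -> linked U u w.
  by move=> /crit c; apply: linked_trans.
have linked_eqv : {in U & &, equivalence_rel (linked U)}.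
  move=> x y z Ux Uy Uz; split; first by apply/linkedP; left.
  move=> lxy; apply/idP/idP; last exact: ltr.
  by apply: ltr => //; rewrite linked_sym.
have pP := equivalence_partitionP linked_eqv.
set P := equivalence_partition (linked U) U in pP.
have inP B : B \in P -> exists2 x, x \in U & B = [set y in U | linked U x y].
  by move=> /imsetP[x Ux ->]; exists x.
exists f, set0, P; split=> //.
  split; rewrite ?sub0set ?setD0 //.
  move=> B /inP[x Ux ->]; split.
  (* [g] matches nodes within their class, since adjacent nodes are linked, and misses no node
     linked to [x] except [x] itself. *)
  - have [g mg gx] := crit x Ux; have [/matchingP[gK mgg] _] := maximumP _ _ mg.
    rewrite (odd_fixed_points gK); last first.
      move=> y; have [->//|/mgg[Uy Ugy ry]] := eqVneq (g y) y.
      rewrite !inE Uy Ugy /= => lxy; apply: ltr lxy _ => //.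
      exact: adjacent_linked.
    suff -> : [set y in [set y in U | linked U x y] | g y == y] = [set x].
      by rewrite cards1.
    apply/setP => y; rewrite !inE; apply/idP/eqP => [/andP[/andP[Uy lxy] gy]|->].
      case/linkedP: lxy => [//|/(_ g mg gx)]; by rewrite inE Uy gy.
    by move: gx; rewrite inE Ux /= => ->; rewrite andbT; apply/linkedP; left.
  - move=> y z; rewrite !inE => /andP[Uy lxy] Uz ryz; rewrite Uz /=.
    by apply: ltr lxy _ => //; apply: adjacent_linked.
rewrite cards0 add0n.
have minU x : x \in missed U f -> x \in U by rewrite inE => /andP[].
(* Two nodes missed by [f] are not linked, so their classes are distinct. *)
rewrite -(card_in_imset (f := fun x => [set y in U | linked U x y])).
  apply: subset_leq_card; apply/subsetP => _ /imsetP[x /minU Ux ->].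
  by apply/imsetP; exists x.
move=> x y mx my /setP/(_ y); rewrite !inE (minU y my) /= => e.
have : linked U x y by rewrite e; apply/linkedP; left.
by case/linkedP => // /(_ f mf mx); rewrite my.
Qed.
End TutteBerge.

(** * Reduced barriers *)

Section ReducedBarrier.
Variables (T : finType) (r : rel T).
Hypothesis r_sym : symmetric r.
Implicit Types (S B : {set T}) (P : {set {set T}}).

Definition touched P x := [set B in P | [exists y in B, r x y]].

Lemma barrier_cover S P x :
  barrier r setT S P -> (x \in cover P) = (x \notin S).
Proof. by case=> _ /cover_partition-> _; rewrite !inE andbT. Qed.

Lemma barrier_notin S P B x :
  barrier r setT S P -> B \in P -> x \in B -> x \notin S.
Proof. by move=> bar PB Bx; rewrite -(barrier_cover _ bar); apply/bigcupP; exists B. Qed.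

Lemma barrier_meet S P B1 B2 x :
  barrier r setT S P -> B1 \in P -> B2 \in P -> x \in B1 -> x \in B2 -> B1 = B2.
Proof.
case=> _ /and3P[_ /trivIsetP tP _] _ PB1 PB2 x1 x2; apply/eqP/negPn/negP.
by move=> /(tP _ _ PB1 PB2)/pred0P/(_ x); rewrite /= x1 x2.
Qed.

Lemma barrier_closed S P B x y :
  barrier r setT S P -> B \in P -> x \in B -> y \notin S -> r x y -> y \in B.
Proof. by case=> _ _ bP /bP[_ cB] Bx Sy; apply: cB; rewrite ?inE ?Sy. Qed.

(* Moving [x] out of [S] glues the two given members and [x] into one odd set. *)
Lemma barrier_merge S P x B1 B2 :
  barrier r setT S P -> x \in S -> B1 \in P -> B2 \in P -> B1 != B2 ->
  touched P x \subset [set B1; B2] ->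
  exists P', barrier r setT (S :\ x) P' /\ #|P| = #|P'|.+1.
Proof.
move=> bar Sx PB1 PB2 nB /subsetP sN.
have [_ /and3P[_ tP P0] bP] := bar.
have [o1 _] := bP _ PB1; have [o2 _] := bP _ PB2.
have xnotin B : B \in P -> x \notin B.
  by move=> PB; apply: contraL Sx; apply: barrier_notin bar PB.
have d12 : B1 :&: B2 = set0.
  by have /trivIsetP/(_ _ _ PB1 PB2 nB) := tP; rewrite -setI_eq0 => /eqP.
pose B0 := x |: (B1 :|: B2).
have inB0 y : (y \in B0) = [|| y == x, y \in B1 | y \in B2] by rewrite !inE.
have cB0 : #|B0| = (#|B1| + #|B2|).+1.
  rewrite cardsU1 inE (negPf (xnotin _ PB1)) (negPf (xnotin _ PB2)).
  by rewrite cardsU d12 cards0 subn0.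
pose Q := P :\ B1 :\ B2.
have inQ B : B \in Q = [&& B != B2, B != B1 & B \in P] by rewrite !inE.
have disQ B y : B \in Q -> y \in B -> y \notin B0.
  rewrite inQ inB0 => /and3P[n2 n1 PB] By; rewrite !negb_or; apply/and3P; split.
  - by apply: contraTneq By => ->; apply: xnotin.
  - by apply: contraNN n1 => y1; rewrite (barrier_meet bar PB PB1 By y1).
  - by apply: contraNN n2 => y2; rewrite (barrier_meet bar PB PB2 By y2).
have B0Q : B0 \notin Q.
  by apply/negP => /disQ/(_ (setU11 _ _)); rewrite setU11.
exists (B0 |: Q); split; last first.
  rewrite cardsU1 B0Q (cardsD1 B1 P) PB1 (cardsD1 B2 (P :\ B1)).
  by rewrite !inE eq_sym nB PB2 -/Q.
split; first exact: subsetT.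
  apply/and3P; split.
  - apply/eqP/setP => y; rewrite in_setD in_setT in_setD1 andbT negb_and negbK.
    rewrite -(barrier_cover y bar); apply/bigcupP/idP.
      move=> [B]; rewrite in_setU1 inQ => /orP[/eqP->|/and3P[_ _ PB]] By.
        move: By; rewrite inB0 => /or3P[->//|y1|y2]; apply/orP; right; apply/bigcupP.
          by exists B1.
        by exists B2.
      by rewrite (_ : y \in cover P) ?orbT //; apply/bigcupP; exists B.
    have [B0y _|] := boolP (y \in B0); first by exists B0; rewrite ?setU11.
    rewrite inB0 !negb_or => /and3P[/negPf-> n1 n2] /= /bigcupP[B PB By].
    exists B => //; rewrite in_setU1 inQ PB andbT; apply/orP; right.
    by apply/andP; split; apply: contraTneq By => ->.
  - apply/trivIsetP => A B; rewrite !in_setU1 => /orP[/eqP->|QA] /orP[/eqP->|QB].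
    + by rewrite eqxx.
    + move=> _; rewrite disjoint_sym; apply/pred0P => y /=; apply/negP => /andP[By].
      by apply/negP; apply: disQ QB By.
    + move=> _; apply/pred0P => y /=; apply/negP => /andP[Ay].
      by apply/negP; apply: disQ QA Ay.
    + move: QA QB; rewrite !inQ => /and3P[_ _ PA] /and3P[_ _ PB].
      exact: (trivIsetP tP).
  - rewrite in_setU1 inQ (negPf P0) !andbF orbF eq_sym.
    by apply/set0Pn; exists x; rewrite setU11.
move=> B; rewrite in_setU1 => /orP[/eqP->|QB].
  split; first by rewrite cB0 /= oddD o1 o2.
  move=> y z B0y; rewrite in_setD in_setT andbT in_setD1 negb_and negbK inB0.
  case/orP=> [->//|Sz]; rewrite inB0 in B0y.
  case/or3P: B0y => [/eqP-> rxz|y1|y2]; first last.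
  - by move/(barrier_closed bar PB2 y2 Sz)->; rewrite !orbT.
  - by move/(barrier_closed bar PB1 y1 Sz)->; rewrite !orbT.
  move: (Sz); rewrite -(barrier_cover _ bar) => /bigcupP[A PA Az].
  have /sN : A \in touched P x by rewrite inE PA; apply/existsP; exists z; rewrite Az.
  by rewrite !inE => /orP[]/eqP<-; rewrite Az ?orbT.
move: QB; rewrite inQ => /and3P[n2 n1 PB]; split; first by have [] := bP B PB.
move=> y z By; rewrite in_setD in_setT andbT in_setD1 negb_and negbK.
case/orP=> [/eqP->|Sz]; last exact: (barrier_closed bar).
rewrite r_sym => rxy; have /sN : B \in touched P x.
  by rewrite inE PB; apply/existsP; exists y; rewrite By.
by rewrite !inE (negPf n1) (negPf n2).
Qed.

Lemma subset_of_card (A P : {set {set T}}) n :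
  A \subset P -> #|A| <= n <= #|P| -> exists N : {set {set T}}, [/\ A \subset N, N \subset P & #|N| = n].
Proof.
elim: n => [|n IHn] sAP /andP[leA leP].
  by exists A; split=> //; apply/eqP; rewrite -leqn0.
have [eA|nA] := eqVneq #|A| n.+1; first by exists A.
have [|N [sAN sNP cN]] := IHn sAP; first by rewrite (ltnW leP) andbT; lia.
have /properP[_ [B PB NB]] : N \proper P by rewrite properEcard sNP cN.
exists (B |: N); split; last by rewrite cardsU1 NB cN.
  by rewrite (subset_trans sAN) ?subsetUr.
by rewrite subUset sub1set PB.
Qed.

(** Merging lowers [#|S|] and [#|P|] by one each, so the strict inequality survives until no node of
    [S] touches at most two members. *)
Lemma reduced_barrier S P :
  barrier r setT S P -> #|S| < #|P| ->
  exists S P, [/\ barrier r setT S P, #|S| < #|P| &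
                  forall x, x \in S -> 2 < #|touched P x|].
Proof.
have [n] := ubnP #|S|; elim: n S P => // n IHn S P leS bar ltSP.
case: (pickP [pred x in S | #|touched P x| <= 2]) => [x /andP[Sx le2]|big].
  (* If fewer than two members are touched, arbitrary ones complete the pair; [#|P|] is at least 2
     because [S] contains [x]. *)
  have [||N [sN sNP /eqP/cards2P[B1 [B2 [nB eN]]]]] := @subset_of_card (touched P x) P 2.
  - by apply/subsetP => B; rewrite inE => /andP[].
  - by rewrite le2; rewrite (cardsD1 x) Sx in ltSP; lia.
  have PB B : B \in [set B1; B2] -> B \in P by rewrite -eN => /(subsetP sNP).
  rewrite eN in sN.
  have [||P' [bar' cP]] := barrier_merge bar Sx _ _ nB sN.
  - by apply: PB; rewrite !inE eqxx.
  - by apply: PB; rewrite !inE eqxx orbT.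
  rewrite (cardsD1 x S) Sx cP in leS ltSP.
  have leS' : #|S :\ x| < n by [].
  exact: IHn leS' bar' ltSP.
exists S, P; split=> // x Sx; rewrite ltnNge; apply/negP => le2.
by have := big x; rewrite /= Sx le2.
Qed.

Theorem perfect_matching_or_barrier :
  (exists f, involutive f /\ forall x, f x != x /\ r x (f x)) \/
  exists S P, [/\ barrier r setT S P, #|S| < #|P| &
                  forall x, x \in S -> 2 < #|touched P x|].
Proof.
have [f [S [P [/matchingP[fK mf] bar leP]]]] := tutte_berge r_sym setT.
have [m0|mn] := eqVneq (missed setT f) set0; [left | right].
  exists f; split=> // x; have fx : f x != x.
    by apply/negP => fx; have := in_set0 x; rewrite -m0 inE fx inE.
  by have [] := mf x fx.
apply: (reduced_barrier bar); apply: leq_trans leP.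
by rewrite -addn1 leq_add2l card_gt0.
Qed.
End ReducedBarrier.

(** In a maximum matching of the graph joining points of equal image, each fibre has at most one
    missed point, hence none by parity. *)
Lemma even_pairing (H V : finType) (s : H -> V) :
  (forall v, ~~ odd #|[set h | s h == v]|) ->
  exists t : H -> H, [/\ involutive t, forall h, t h != h & forall h, s (t h) = s h].
Proof.
move=> ev; pose r h h' := s h == s h'.
have r_sym : symmetric r by move=> h h'; rewrite /r eq_sym.
have [f mf] := maximum_exists r setT.
have /maximumP[/matchingP[fK fr] _] := mf.
have sf h : s (f h) = s h.
  by have [->//|/fr[_ _ /eqP]] := eqVneq (f h) h.
exists f; split=> // h; apply/negP => fh.
have mh x : f x == x -> x \in missed setT f by move=> fx; rewrite !inE.
case/negP: (ev (s h)); rewrite (odd_fixed_points fK); last first.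
  by move=> x; rewrite !inE sf.
suff -> : [set x in [set h' | s h' == s h] | f x == x] = [set h] by rewrite cards1.
apply/setP => x; rewrite !inE; apply/andP/eqP => [[sx fx]|->]; last by rewrite eqxx.
apply/eqP/negPn/negP => nx; have := missed_not_adjacent r_sym mf (mh _ fx) (mh _ fh) nx.
by rewrite /r sx.
Qed.

(** * Closed walks from even degrees *)

Lemma all_zip_map (H X Y : Type) (p : pred (X * Y)) (a : H -> X) (b : H -> Y) s :
  all p (zip (map a s) (map b s)) = all (fun h => p (a h, b h)) s.
Proof. by elim: s => //= h s ->. Qed.

Lemma rot1_orbit (H : finType) (g : H -> H) (x : H) :
  injective g -> rot 1 (orbit g x) = map g (orbit g x).
Proof.
move=> injg; have traj n y : map g (traject g y n) = traject g (g y) n.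
  by elim: n y => //= n IHn y; rewrite IHn.
rewrite /orbit traj -orderSpred trajectS rot1_cons trajectSr -iterSr orderSpred.
by rewrite iter_order.
Qed.

Section EulerFamily.
Variables (V E : finType) (inc : E -> {set V}) (src : E * bool -> V).
Let flip (h : E * bool) := (h.1, ~~ h.2).

Hypothesis src_inc : forall h, src h \in inc h.1.
Hypothesis src_neq : forall h, src (flip h) != src h.
Hypothesis src_even : forall v, ~~ odd #|[set h | src h == v]|.

(* Half-edges are joined at the vertices by a fixed-point-free involution [t]
   preserving [src]; the orbits of [t \o flip] are directed closed walks, and
   [flip] exchanges each of them with its reversal. *)
Lemma euler_of_even : quasi_eulerian inc.
Proof.
have [t [tK t_neq src_t]] := even_pairing src_even.
have flipK : involutive flip by case=> e b; rewrite /flip /= negbK.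
have flip_neq h : flip h != h by apply: contraNneq (src_neq h) => ->.
pose g h := t (flip h).
have injg : injective g by apply: inj_comp (can_inj tK) (can_inj flipK).
have g_flip h : g (flip (g h)) = flip h by rewrite /g flipK tK.
(* Cancelling one step at each end shortens such a path by two, down to a fixed point of [flip] or
   of [t]. *)
have not_rev i h : iter i g h <> flip h.
  have [n] := ubnP i; elim: n i h => // n IHn [|[|i]] h ltin e.
  - by have := flip_neq h; rewrite -e eqxx.
  - by have := t_neq (flip h); rewrite -/(g h) [g h]e eqxx.
  apply: (IHn i (g h)); first by lia.
  by rewrite -[LHS]flipK -[in RHS](flipK (g h)); congr flip;
     rewrite flipK -iterSr; apply: (can_inj tK); rewrite -/(g _) -iterS e /g tK.
have rootE h h' : (froot g h == froot g h') = fconnect g h h'.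
  exact/root_connect/fconnect_sym.
have root_g h : froot g (g h) = froot g h.
  by apply/eqP; rewrite eq_sym rootE fconnect1.
have root_flip_g h : froot g (flip (g h)) = froot g (flip h).
  by apply/eqP; rewrite rootE -(g_flip h) fconnect1.
have root_neq h : froot g h != froot g (flip h).
  rewrite rootE; apply/negP => c; apply: (@not_rev (findex g h (flip h)) h).
  exact: iter_findex.
(* Comparing the ranks of the roots selects one orbit from each pair of mutually reversed ones. *)
pose X h := enum_rank (froot g h) < enum_rank (froot g (flip h)).
have X_flip h : X (flip h) = ~~ X h.
  rewrite /X flipK -leqNgt [in RHS]leq_eqVlt.
  by rewrite (inj_eq (@ord_inj _)) (inj_eq enum_rank_inj) eq_sym (negPf (root_neq h)).
have X_connect h h' : fconnect g h h' -> X h' = X h.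
  move=> c; rewrite -(iter_findex c); elim: (findex _ _ _) => //= n.
  by rewrite /X root_g root_flip_g.
pose R := [seq h <- enum (froots g) | X h].
exists [seq [seq (src h, h.1) | h <- orbit g x] | x <- R]; split.
  apply/allP => _ /mapP[x _ ->]; rewrite /closed_walk -!map_rot rot1_orbit //.
  rewrite -!map_comp all_zip_map; apply/allP => h _ /=.
  have srcg : src (g h) = src (flip h) by rewrite /g src_t.
  by rewrite srcg src_inc (src_inc (flip h)) eq_sym src_neq.
move=> e.
have -> : flatten [seq [seq (src h, h.1) | h <- orbit g x] | x <- R] =
          map (fun h => (src h, h.1)) (flatten [seq orbit g x | x <- R]).
  by rewrite map_flatten -map_comp.
rewrite count_map.
have /permP-> : perm_eq (flatten [seq orbit g x | x <- R]) (enum X).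
  apply: uniq_perm; rewrite ?enum_uniq //.
    have -> : flatten [seq orbit g x | x <- R] = [seq h | x <- R, h <- orbit g x].
      by congr flatten; apply: eq_map => x; rewrite map_id.
    apply: allpairs_uniq_dep => [|x _|]; first exact/filter_uniq/enum_uniq.
      exact: orbit_uniq.
    move=> _ _ /allpairsPdep[x [h [Rx xh ->]]] /allpairsPdep[y [k [Ry yk ->]]] /= ehk.
    rewrite {}ehk in xh *.
    have fr z : z \in R -> froot g z = z.
      by rewrite mem_filter mem_enum => /andP[_ /eqP].
    move: xh yk; rewrite -!fconnect_orbit => /(rootP (fconnect_sym injg)) + /(rootP (fconnect_sym injg)).
    by rewrite (fr x Rx) (fr y Ry) => -> ->.
  move=> h; rewrite mem_enum; apply/flatten_mapP/idP.
    case=> x; rewrite mem_filter -fconnect_orbit => /andP[Xx _] /X_connect eX.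
    by rewrite -topredE /= eX.
  rewrite -topredE /= => Xh; exists (froot g h).
    rewrite mem_filter mem_enum [_ \in _](roots_root (fconnect_sym injg)) andbT.
    by rewrite (X_connect h) // connect_root.
  by rewrite -fconnect_orbit fconnect_sym // connect_root.
(* Exactly one of the two half-edges of [e] satisfies [X], so [e] is traversed once. *)
pose he := if X (e, true) then (e, true) else (e, false).
have Xe b : X (e, b) = ((e, b) == he).
  rewrite /he; have := X_flip (e, true); rewrite /flip /= => eX.
  by case: b; rewrite ?eX; case: (X (e, true)); rewrite ?eqxx //= -pair_eqE /= ?andbF.
rewrite -size_filter -(card1 he) cardE {1}/enum_mem -filter_predI.
congr size; apply: eq_filter => -[e' b] /=; rewrite -topredE /=.
have [->|ne] := eqVneq e' e; first exact: Xe.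
by apply/esym/negbTE; apply: contra_neqN ne => /eqP; rewrite /he; case: ifP => _ [].
Qed.
End EulerFamily.

(** * The matching gadget of a hypergraph *)

Lemma even_free_involution (T : finType) (f : T -> T) (A : {set T}) :
  involutive f -> (forall x, f x != x) -> {in A, forall x, f x \in A} ->
  ~~ odd #|A|.
Proof.
move=> fK f_neq fA; rewrite (odd_fixed_points fK fA).
suff -> : [set x in A | f x == x] = set0 by rewrite cards0.
by apply/setP => x; rewrite !inE (negPf (f_neq x)) andbF.
Qed.

Lemma card_sumset (X Y : finType) (A : {set X + Y}) :
  #|A| = #|[set x | inl x \in A]| + #|[set y | inr y \in A]|.
Proof.
have inl_inj : injective (@inl X Y) by move=> x y [].
have inr_inj : injective (@inr X Y) by move=> x y [].
rewrite -(card_imset _ inl_inj) -(card_imset _ inr_inj) -cardsUI.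
rewrite (_ : _ :&: _ = set0) ?cards0 ?addn0; last first.
  by apply/setP => z; rewrite !inE; apply/negP => /andP[/imsetP[x _ ->] /imsetP[]].
apply: eq_card => -[x|y]; rewrite !inE.
  rewrite mem_imset // inE orbC; case: (_ \in inr @: _) / imsetP => //= -[] //.
rewrite [in RHS](mem_imset _ _ inr_inj) inE; case: (_ \in inl @: _) / imsetP => //= -[] //.
Qed.

(** The quotient is the ceiling of [k / c]. *)
Lemma ceil_div_mul k c : 0 < c -> k <= c * ((k + c.-1) %/ c).
Proof. by move=> c0; have := divn_eq (k + c.-1) c; have := ltn_pmod (k + c.-1) c0; lia. Qed.

(* For odd [t], either [t = 1] and [s >= k / c], or [t >= 3]. *)
Lemma weighted_cut k c m t s : 2 < c -> k <= c * m -> odd t -> m < t + s ->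
  c * k <= k * (c - 2) * t + 2 * c * s.
Proof.
case: c => [|[|[|c]]] // _ km; rewrite (_ : c.+3 - 2 = c.+1) //.
(* For [t = 1], the bound [k <= c * s] supplies the missing [2 * k]; for [t >= 3],
   [3 * (c - 2) >= c] because [c >= 3]. *)
case: t => [|[|[|t]]] // _ lt; first by nia.
have : k * c.+1 * 3 <= k * c.+1 * t.+3 by rewrite leq_mul2l orbT.
nia.
Qed.

(** Divide the last hypothesis by [k], add [2 * c * n <= 2 * D], then divide by [c]. *)
Lemma weighted_total k c p D s n : 2 < c -> 0 < k -> c * n <= D ->
  p * (c * k) <= k * (c - 2) * D + 2 * c * (k * s) -> p + 2 * n <= D + 2 * s.
Proof.
case: c => [|[|[|c]]] // _ k0 cn; rewrite (_ : c.+3 - 2 = c.+1) // => le.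
have le1 : p * c.+3 <= c.+1 * D + 2 * c.+3 * s.
  rewrite -(leq_pmul2l k0); lia.
rewrite -(leq_pmul2l (ltn0Sn c.+2)); lia.
Qed.

Section Gadget.
Variables (V E : finType) (inc : E -> {set V}).
Notation half := (E * bool)%type.
Notation node := (V * half + half)%type.

(* A vertex [v] becomes the clique of the [inl (v, p)], of even size [2 #|E|]; an
   edge [e] becomes two nodes [inr (e, _)], adjacent to the clique node
   [inl (v, (e, true))] for each [v \in inc e]. *)
Definition gadget_adj : rel node := fun x y =>
  match x, y with
  | inl (v, _), inl (w, _) => v == w
  | inl (v, p), inr h | inr h, inl (v, p) =>
      (p == (h.1, true)) && (v \in inc h.1)
  | inr _, inr _ => false
  end.

Lemma gadget_sym : symmetric gadget_adj.
Proof. by move=> [[v p]|h] [[w q]|k] //=; rewrite eq_sym. Qed.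

(** The partner of [inr h] lies in the clique of some vertex, which is taken as [src h]. *)
Lemma euler_of_perfect_matching f :
  involutive f -> (forall x, f x != x /\ gadget_adj x (f x)) -> quasi_eulerian inc.
Proof.
move=> fK mf.
have f_inr h : exists v, v \in inc h.1 /\ f (inr h) = inl (v, (h.1, true)).
  have [_] := mf (inr h); case: (f (inr h)) => [[v p]|//] /= /andP[/eqP-> vh].
  by exists v.
have [src src_f] := fin_all_exists f_inr.
apply: (@euler_of_even _ _ _ src) => [h|[e b]|v]; first by have [] := src_f h.
  (* Twins sent to the same vertex would share the partner [inl (v, (e, true))]. *)
  apply/eqP => e_src; have [_ f1] := src_f (e, b); have [_] := src_f (e, ~~ b).
  by rewrite /= e_src -f1 => /(can_inj fK)[]; case: b {e_src f1}.
(* The clique of [v] and the half-edges matched into it are closed under [f]; the clique is even, so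
   these half-edges are even in number. *)
pose A : {set node} := [set x | match x with inl (w, _) => w == v | inr h => src h == v end].
have fA : {in A, forall x, f x \in A}.
  move=> [[w p]|h]; rewrite !inE => /eqP ev; last first.
    by have [_ ->] := src_f h; rewrite ev eqxx.
  rewrite ev; have [_] := mf (inl (v, p)); case fx: (f _) => [[w' q]|h] /=.
    by rewrite eq_sym.
  by move=> _; have [_] := src_f h; rewrite -fx fK => -[->].
have := even_free_involution fK (fun x => proj1 (mf x)) fA.
rewrite card_sumset oddD negb_add.
have /negPf-> : ~~ odd #|[set x | inl x \in A]|.
  apply: (@even_free_involution _ (fun x => (x.1, (x.2.1, ~~ x.2.2)))).
  - by move=> [w [e b]]; rewrite /= negbK.
  - by move=> [w [e b]]; rewrite !xpair_eqE; case: b; rewrite !andbF.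
  - by move=> [w p]; rewrite !inE.
by rewrite eq_sym => /eqP/negbT; congr (~~ odd _); apply: eq_card => h; rewrite !inE.
Qed.

Definition flags_on (X : {set E}) : {set V * E} :=
  [set p | (p.2 \in X) && (p.1 \in inc p.2)].

Lemma mem_flags_on X v e : ((v, e) \in flags_on X) = (e \in X) && (v \in inc e).
Proof. by rewrite inE. Qed.

Lemma card_flags_on X : #|flags_on X| = \sum_(e in X) #|inc e|.
Proof.
rewrite -sum1_card (partition_big snd (mem X)) /=; last first.
  by move=> p; rewrite inE => /andP[].
apply: eq_bigr => e Xe; rewrite sum1_card.
rewrite -(card_imset (mem (inc e)) (f := fun v => (v, e))); last by move=> v w [].
apply: eq_card => -[v e']; rewrite unfold_in !inE /=.
apply/andP/imsetP => [[/andP[_ ve] /eqP<-]|[w we [-> ->]]]; first by exists v.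
by rewrite Xe eqxx.
Qed.

Hypotheses (inc0 : is_hypergraph inc) (crk3 : 2 < crk inc).
Let m := (rk inc + (crk inc).-1) %/ crk inc.
Hypothesis conn : inc_edge_connected inc m.+1.

Lemma crk_le e : crk inc <= #|inc e|.
Proof.
rewrite /crk; have := mem_index_enum e; elim: (index_enum E) => //= a s IHs.
rewrite big_cons inE => /orP[/eqP->|/IHs]; first exact: geq_minl.
by apply: leq_trans; apply: geq_minr.
Qed.

Lemma rk_gt0 : 0 < rk inc.
Proof.
(* The minimum defining [crk] has default value [rk], so [rk = 0] would force [crk = 0]. *)
rewrite lt0n; apply: contraTneq crk3 => rk0; rewrite /crk rk0 -leqNgt.
by elim: (index_enum E) => [|e s IHs]; rewrite ?big_nil // big_cons geq_min IHs orbT.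
Qed.

(** * Shape of a reduced barrier of the gadget *)

Section Barrier.
Variables (S : {set node}) (P : {set {set node}}).
Hypothesis bar : barrier gadget_adj setT S P.
Hypothesis big : forall x, x \in S -> 2 < #|touched gadget_adj P x|.

Lemma clique_same B v p q :
  B \in P -> inl (v, p) \in B -> inl (v, q) \notin S -> inl (v, q) \in B.
Proof. by move=> PB Bx Sy; apply: (barrier_closed bar PB Bx Sy); rewrite /= eqxx. Qed.

Lemma flag_down B v e b :
  B \in P -> v \in inc e -> inl (v, (e, true)) \in B -> inr (e, b) \notin S ->
  inr (e, b) \in B.
Proof.
move=> PB ve Bx Sy; apply: (barrier_closed bar PB Bx Sy).
by rewrite /= eqxx.
Qed.

Lemma flag_up B v e b :
  B \in P -> v \in inc e -> inr (e, b) \in B -> inl (v, (e, true)) \notin S ->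
  inl (v, (e, true)) \in B.
Proof.
move=> PB ve Bx Sy; apply: (barrier_closed bar PB Bx Sy).
by rewrite /= eqxx.
Qed.

(** The clique of [v] off [S] lies in a single member, and the only other possible neighbours are
    the two twins of [e]. Touching three members therefore requires both twins, in different
    members. *)
Lemma clique_node_in_barrier v e b :
  inl (v, (e, b)) \in S ->
  [/\ b, v \in inc e & exists C0 C1, [/\ C0 \in P, C1 \in P, C0 != C1,
        inr (e, false) \in C0 & inr (e, true) \in C1]].
Proof.
move=> Sx; pose kind (k : option bool) (B : {set node}) := match k with
  | None => exists p, inl (v, p) \in B
  | Some i => [/\ b, v \in inc e & inr (e, i) \in B] end.
have kind_inj k B B' : B \in P -> B' \in P -> kind k B -> kind k B' -> B = B'.
  move=> PB PB'; case: k => [i|] /=.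
    by move=> [_ _ Bi] [_ _ B'i]; apply: (barrier_meet bar PB PB' Bi B'i).
  move=> [p Bp] [q B'q]; apply: (barrier_meet bar PB PB' _ B'q).
  by apply: (clique_same PB Bp); apply: barrier_notin bar PB' B'q.
have kindP B : B \in touched gadget_adj P (inl (v, (e, b))) -> B \in P /\ exists k, kind k B.
  rewrite inE => /andP[PB /existsP[[[w p]|[e' i]] /andP[By]]] /=.
    by move=> /eqP ev; split=> //; exists None; exists p; rewrite ev.
  move=> /andP[/eqP[ee eb] ve]; split=> //; exists (Some i).
  by rewrite /= ee eb; split.
have /card_gt2P[B1 [B2 [B3 [[N1 N2 N3] [n12 n23 n31]]]]] := big Sx.
have [P1 [k1 K1]] := kindP _ N1; have [P2 [k2 K2]] := kindP _ N2.
have [P3 [k3 K3]] := kindP _ N3.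
have fin C0 C1 : C0 \in P -> C1 \in P -> C0 != C1 ->
  kind (Some false) C0 -> kind (Some true) C1 ->
  [/\ b, v \in inc e & exists C0 C1, [/\ C0 \in P, C1 \in P, C0 != C1,
        inr (e, false) \in C0 & inr (e, true) \in C1]].
  by move=> PC0 PC1 nC [bt ve h0] [_ _ h1]; split=> //; exists C0, C1.
have n21 : B2 != B1 by rewrite eq_sym.
have n32 : B3 != B2 by rewrite eq_sym.
have n13 : B1 != B3 by rewrite eq_sym.
have bad k B B' : B \in P -> B' \in P -> B != B' -> kind k B -> kind k B' -> False.
  by move=> PB PB' /eqP nB kB kB'; apply: nB; apply: kind_inj kB kB'.
by case: k1 K1 => [[]|] K1; case: k2 K2 => [[]|] K2; case: k3 K3 => [[]|] K3;
  by [ case: (bad _ _ _ P1 P2 n12 K1 K2) | case: (bad _ _ _ P2 P3 n23 K2 K3)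
     | case: (bad _ _ _ P3 P1 n31 K3 K1)
     | apply: fin K1 K2 | apply: fin K2 K1 | apply: fin K1 K3
     | apply: fin K3 K1 | apply: fin K2 K3 | apply: fin K3 K2].
Qed.

Let T : {set E} := [set e | [exists v, inl (v, (e, true)) \in S]].
Let SE : {set E} := [set e | inr (e, false) \in S].

(** A flag node of [e] off [S] would be adjacent to both twins of [e] and put them in the same
    member. *)
Lemma T_clique v e : e \in T -> v \in inc e -> inl (v, (e, true)) \in S.
Proof.
rewrite inE => /existsP[w Sw] ve.
have [_ _ [C0 [C1 [P0 P1 /eqP nC h0 h1]]]] := clique_node_in_barrier Sw.
apply/negPn/negP => Sv; apply: nC.
exact: (barrier_meet bar P0 P1 (flag_up P0 ve h0 Sv) (flag_up P1 ve h1 Sv)).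
Qed.

Lemma clique_barrierE v e b :
  (inl (v, (e, b)) \in S) = [&& b, e \in T & v \in inc e].
Proof.
apply/idP/and3P => [Sx|[bt Te ve]]; last by move: bt => ->; apply: T_clique.
have [bt ve _] := clique_node_in_barrier Sx; split=> //.
by move: Sx; rewrite inE bt => Sx; apply/existsP; exists v.
Qed.

(** Twins have the same neighbours. If the other twin were off [S], its member would contain all
    these neighbours off [S], and [inr (e, b)] would touch only one member. *)
Lemma half_barrier_twin e b : inr (e, b) \in S -> inr (e, ~~ b) \in S.
Proof.
move=> Sx; apply/negPn/negP => Sy; have := big Sx.
rewrite ltnNge => /negP; apply; rewrite (@leq_trans 1) //.
apply/card_le1P => B; rewrite inE => /andP[PB /existsP[y /andP[By ry]]] B'.
rewrite [B' \in _]inE [B' \in pred1 B]inE; apply/idP/eqP => [|->]; last first.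
  by rewrite PB; apply/existsP; exists y; rewrite By.
move=> /andP[PB' /existsP[y' /andP[By' ry']]].
have inB C z : C \in P -> z \in C -> gadget_adj (inr (e, b)) z -> inr (e, ~~ b) \in C.
  move=> PC; case: z => [[v p]|//] Cz /= /andP[/eqP ep ve].
  by apply: (flag_down PC ve) => //; rewrite -ep.
exact: (barrier_meet bar PB' PB (inB _ _ PB' By' ry') (inB _ _ PB By ry)).
Qed.

Lemma half_barrierE e b : (inr (e, b) \in S) = (e \in SE).
Proof.
rewrite inE; case: b => //.
by apply/idP/idP => /half_barrier_twin.
Qed.

Lemma card_barrier : #|flags_on T| + 2 * #|SE| <= #|S|.
Proof.
rewrite (card_sumset S) leq_add //.
  rewrite -(card_imset (flags_on T) (f := fun p => (p.1, (p.2, true)))).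
    apply: subset_leq_card; apply/subsetP => _ /imsetP[[v e] + ->].
    by rewrite mem_flags_on inE clique_barrierE.
  by move=> [v e] [w e'] [-> ->].
have -> : [set y | inr y \in S] = setX SE setT.
  by apply/setP => -[e b]; rewrite inE half_barrierE in_setX in_setT andbT.
by rewrite cardsX cardsT card_bool mulnC.
Qed.

(** * Coboundaries of the odd sets and the final count *)

Let P1 : {set {set node}} := [set B in P | [exists h : half, (h.1 \in T) && (inr h \in B)]].
Let P2 := P :\: P1.
(** [VB B] and [EB B] form the trace of [B] on the incidence graph. *)
Let VB (B : {set node}) := [set v | [exists p, inl (v, p) \in B]].
Let EB (B : {set node}) := [set e | inr (e, false) \in B].

Lemma card_P1 : #|P1| <= 2 * #|T|.
Proof.
have [_ /and3P[_ tP _] _] := bar.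
apply: (@leq_trans #|[set pblock P (inr h) | h in setX T setT]|).
  apply: subset_leq_card; apply/subsetP => B; rewrite inE.
  move=> /andP[PB /existsP[[e b] /andP[Th Bh]]]; apply/imsetP; exists (e, b).
    by rewrite in_setX Th in_setT.
  by rewrite (def_pblock tP PB Bh).
by apply: leq_trans (leq_imset_card _ _) _; rewrite cardsX cardsT card_bool mulnC.
Qed.

Lemma P2P B : B \in P2 -> B \in P /\ forall e b, inr (e, b) \in B -> e \notin T.
Proof.
rewrite in_setD in_set => /andP[+ PB]; rewrite PB => /existsPn nB; split=> // e b Be.
by have := nB (e, b); rewrite Be andbT.
Qed.

Lemma mem_VB B v p : B \in P -> v \in VB B -> inl (v, p) \notin S -> inl (v, p) \in B.
Proof. by move=> PB; rewrite inE => /existsP[q]; apply: clique_same. Qed.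

(** As [e] is nonempty and outside [T], it has a flag node off [S], adjacent to both twins. *)
Lemma P2_twin B e b : B \in P2 -> inr (e, b) \in B -> inr (e, ~~ b) \in B.
Proof.
move=> /P2P[PB nT] Be; have /set0Pn[v ve] := inc0 e.
have Sv : inl (v, (e, true)) \notin S by rewrite clique_barrierE (negPf (nT _ _ Be)).
apply: (flag_down PB ve (flag_up PB ve Be Sv)).
by rewrite half_barrierE -(half_barrierE e b); apply: barrier_notin bar PB Be.
Qed.

(** For [B] in [P2], no edge of [T] or [SE] is in [EB B], so with [X] either of them these flags
    belong to the coboundary of the trace of [B]. *)
Let cut (X : {set E}) B := [set p in flags_on X | p.1 \in VB B].

Lemma mem_cut X B v e :
  ((v, e) \in cut X B) = [&& e \in X, v \in inc e & v \in VB B].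
Proof. by rewrite in_set mem_flags_on andbA. Qed.

(** Adding to [B] the nodes of [S] in the cliques it meets gives a set [K] of whole cliques and twin
    pairs, which is even. [B] is odd, and the added nodes correspond to [cut T B]. *)
Lemma odd_cut B : B \in P2 -> odd #|cut T B|.
Proof.
move=> P2B; have [PB nT] := P2P P2B; have [_ _ bP] := bar; have [oB _] := bP B PB.
pose c (p : V * E) : node := inl (p.1, (p.2, true)).
have c_inj : injective c by move=> [v e] [w e'] [-> ->].
pose K := B :|: c @: cut T B.
have inlK v p : (inl (v, p) \in K) = (v \in VB B).
  rewrite inE; apply/orP/idP => [[Bx|/imsetP[[w e]]]|vB].
  - by rewrite inE; apply/existsP; exists p.
  - by rewrite mem_cut => /and3P[_ _ wB] [-> _].
  have [Sx|/(mem_VB PB vB)] := boolP (inl (v, p) \in S); [right|by left].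
  move: Sx; case: p => e b; rewrite clique_barrierE => /and3P[-> Te ve].
  by apply/imsetP; exists (v, e); rewrite // mem_cut Te ve.
have inrK h : (inr h \in K) = (inr h \in B).
  by rewrite inE orbC; case: imsetP => // -[].
have : ~~ odd #|K|.
  pose flip (x : node) : node := match x with
    | inl (v, (e, b)) => inl (v, (e, ~~ b)) | inr (e, b) => inr (e, ~~ b) end.
  apply: (@even_free_involution _ flip).
  - by move=> [[v [e b]]|[e b]]; rewrite /= negbK.
  - by move=> [[v [e b]]|[e b]]; apply/eqP => -[]; case: b.
  - by move=> [[v [e b]]|[e b]] /=; rewrite ?inlK ?inrK //; apply: P2_twin.
rewrite cardsU (_ : B :&: _ = set0) ?cards0 ?subn0 ?card_imset ?oddD ?oB ?negbK //.
apply/setP => x; rewrite in_setI in_set0; apply/negP => /andP[Bx /imsetP[[v e]]].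
rewrite mem_cut => /and3P[Te ve _] ex; move: (barrier_notin bar PB Bx).
by rewrite ex clique_barrierE Te ve.
Qed.

(** Deleting both cuts separates the trace of [B] from the rest. The separation is proper: by parity
    [cut T B] has a flag, whose vertex is in the trace and whose edge is not. *)
Lemma cut_large B : B \in P2 -> m < #|cut T B| + #|cut SE B|.
Proof.
move=> P2B; have [PB nT] := P2P P2B; rewrite ltnNge; apply/negP => lem.
pose F := cut T B :|: cut SE B.
have FS : F \subset flags inc.
  by apply/subsetP => p; rewrite !inE => /orP[]/andP[/andP[_ ->]].
have Fm : #|F| < m.+1.
  by rewrite ltnS; apply: leq_trans lem; rewrite cardsU leq_subr.
have [[v e]] : exists p, p \in cut T B.
  by apply/set0Pn; rewrite -card_gt0; case: #|_| (odd_cut P2B).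
rewrite mem_cut => /and3P[Te ve vB].
have sides w a : w \in inc a -> (w, a) \notin F -> (w \in VB B) = (a \in EB B).
  move=> wa Fwa; apply/idP/idP => [wB|]; last first.
    rewrite inE => Ba; rewrite inE; apply/existsP; exists (a, true).
    by apply: (flag_up PB wa Ba); rewrite clique_barrierE (negPf (nT _ _ Ba)).
  have [nTa nSa] : a \notin T /\ a \notin SE.
    apply/andP; rewrite -negb_or; apply: contra Fwa.
    by rewrite in_setU !mem_cut wa wB !andbT.
  rewrite inE; apply: (flag_down PB wa (mem_VB PB wB _)).
    by rewrite clique_barrierE (negPf nTa).
  by rewrite half_barrierE.
pose side : {pred V + E} := [pred x | match x with inl w => w \in VB B | inr a => a \in EB B end].
have side_closed : closed (inc_adj inc F) side.
  move=> [w|a] [w'|a'] //= /andP[wa Fwa].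
    exact: sides wa Fwa.
  exact/esym/(sides _ _ wa Fwa).
have Be : (v \in VB B) = (e \in EB B).
  have := closed_connect side_closed (conn FS Fm (inl v) (inr e)).
  by rewrite -!topredE.
by move: Be; rewrite vB inE => /esym/nT; rewrite Te.
Qed.

(** Each flag is counted at most once, since the clique of its vertex meets at most one member. *)
Lemma sum_cut X : \sum_(B in P2) #|cut X B| <= #|flags_on X|.
Proof.
rewrite (eq_bigr (fun B => \sum_(p in flags_on X) (p.1 \in VB B : nat))); last first.
  move=> B _; rewrite -sum1_card big_mkcond [RHS]big_mkcond /=.
  by apply: eq_bigr => p _; rewrite [p \in cut _ _]inE; case: (p \in flags_on X) => //=; case: ifP.
rewrite exchange_big -sum1_card; apply: leq_sum => p _ /=.
rewrite -big_mkcondr sum1_card; apply/card_le1_eqP => B B'.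
rewrite -!topredE => /andP[/P2P[PB _] vB] /andP[/P2P[PB' _]].
rewrite inE => /existsP[q B'q].
exact: (barrier_meet bar PB' PB B'q (mem_VB PB vB (barrier_notin bar PB' B'q))).
Qed.

(** [P1] has at most [2 * #|T|] members. Summing [weighted_cut] over [P2], with edge sizes at least
    [crk] on [T] and at most [rk] on [SE], bounds [#|P2|] through [weighted_total]. *)
Lemma barrier_small : #|P| <= #|S|.
Proof.
apply: leq_trans card_barrier.
have cT : crk inc * #|T| <= #|flags_on T|.
  by rewrite card_flags_on mulnC -sum_nat_const; apply: leq_sum => e _; apply: crk_le.
have cS : #|flags_on SE| <= rk inc * #|SE|.
  rewrite card_flags_on mulnC -sum_nat_const; apply: leq_sum => e _.
  exact: (@leq_bigmax _ (fun e => #|inc e|)).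
apply: leq_trans (weighted_total (p := #|P2|) crk3 rk_gt0 cT _).
  rewrite -(cardsID P1 P) addnC leq_add2l (leq_trans _ card_P1) //.
  by rewrite subset_leq_card // subsetIr.
have leT := sum_cut T; have leS := sum_cut SE.
apply: (@leq_trans (rk inc * (crk inc - 2) * (\sum_(B in P2) #|cut T B|)
    + 2 * crk inc * (\sum_(B in P2) #|cut SE B|))); last first.
  by rewrite leq_add // leq_mul2l ?leT ?(leq_trans leS cS) ?orbT.
rewrite -sum_nat_const [X in _ <= X + _]big_distrr [X in _ <= _ + X]big_distrr.
rewrite -big_split /=; apply: leq_sum => B P2B.
apply: (weighted_cut (m := m)) => //.
- by apply: ceil_div_mul; apply: leq_trans crk3.
- exact: odd_cut.
- exact: cut_large.
Qed.
End Barrier.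

Lemma quasi_eulerian_of_edge_connected : quasi_eulerian inc.
Proof.
case: (perfect_matching_or_barrier gadget_sym) => [[f [fK mf]]|].
  exact: euler_of_perfect_matching mf.
case=> S [P [bar ltSP big]]; have := barrier_small bar big.
by rewrite leqNgt ltSP.
Qed.
End Gadget.

Theorem theorem1p1 (V E : finType) (inc : E -> {set V}) :
  is_hypergraph inc ->
  3 <= crk inc ->
  inc_edge_connected inc (1 + (rk inc + (crk inc).-1) %/ crk inc) ->
  quasi_eulerian inc.
Proof. exact: quasi_eulerian_of_edge_connected. Qed.
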